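(* For positive integers $r,n$, define $$A_{n}^{(r)}(x,y,s,t,p,q)=\sum_{\pi^c\in\mathbb{Z}_r\wr\mathcal{S}_n}x^{\mathrm{exc}_A(\pi^c)}y^{\mathrm{aexc}_A(\pi^c)}s^{\mathrm{single}(\pi^c)}t^{\mathrm{fix}(\pi^c)}p^{\mathrm{csum}(\pi^c)}q^{\mathrm{cyc}(\pi^c)}.$$ Then $$A_{n}^{(r)}(x,y,s,t,p,q)=\sum_{\pi\in\mathcal{S}_n}(x+p[r-1]_py)^{\mathrm{exc}(\pi)}([r]_py)^{\mathrm{drop}(\pi)}(t+sp[r-1]_p)^{\mathrm{fix}(\pi)}q^{\mathrm{cyc}(\pi)},$$ equivalently $$A_{n}^{(r)}(x,y,s,t,p,q)=[r]_p^ny^nA_n\left(\frac{x+p[r-1]_py}{[r]_py},\frac{t+sp[r-1]_p}{[r]_py},q\right).$$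
   Context: $[m]_p=1+p+\cdots+p^{m-1}$ for $m\geqslant1$, $[0]_p=0$. $A_n(x,p,q)=\sum_{\pi\in\mathcal{S}_n}x^{\mathrm{exc}(\pi)}p^{\mathrm{fix}(\pi)}q^{\mathrm{cyc}(\pi)}$, where for $\pi\in\mathcal{S}_n$, $\mathrm{exc}(\pi)=\#\{i:\pi(i)>i\}$, $\mathrm{drop}(\pi)=\#\{i:\pi(i)<i\}$, $\mathrm{fix}(\pi)=\#\{i:\pi(i)=i\}$, $\mathrm{cyc}$ the number of cycles. $\mathbb{Z}_r\wr\mathcal{S}_n$ is the set of $r$-colored permutations $\pi^c=\pi_1^{c_1}\cdots\pi_n^{c_n}$ with $\pi\in\mathcal{S}_n$, $c_i\in\{0,\dots,r-1\}$. Statistics: $\mathrm{exc}_A(\pi^c)=\#\{i:c_i=0,\ \pi_i>i\}$; $\mathrm{fix}(\pi^c)=\#\{i:\pi_i=i,\ c_i=0\}$; $\mathrm{single}(\pi^c)=\#\{i:\pi_i=i,\ c_i>0\}$; $\mathrm{aexc}_A(\pi^c)=n-\mathrm{exc}_A(\pi^c)-\mathrm{fix}(\pi^c)-\mathrm{single}(\pi^c)$ (the number of $i$ with either $c_i=0$ and $\pi_i<i$, or $c_i>0$ and $\pi_i\neq i$); $\mathrm{csum}(\pi^c)=\sum_ic_i$; $\mathrm{cyc}(\pi^c)$ is the number of cycles of $\pi$. *)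

(* Defs.v *)
From mathcomp Require Import all_boot all_order all_algebra all_fingroup.

Set Implicit Arguments.
Unset Strict Implicit.
Unset Printing Implicit Defensive.

Import GRing.Theory.
Local Open Scope ring_scope.

(* Positions and letters are 0-based ('I_n instead of {1, ..., n}); all the
   statistics below are invariant under this shift. *)

Section PermStatistics.
Variable n : nat.
Implicit Type pi : 'S_n.

Definition pexc pi : nat := #|[set i : 'I_n | (i < pi i)%N]|.
Definition pdrop pi : nat := #|[set i : 'I_n | (pi i < i)%N]|.
Definition pfix pi : nat := #|[set i : 'I_n | pi i == i]|.
Definition pcyc pi : nat := #|porbits pi|.

End PermStatistics.

(* Elements of Z_r wr S_n: (pi, c) encodes pi_1^{c_1} ... pi_n^{c_n}, so that
   c i is the color carried by the letter in position i. *)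
Definition colored_perm (r n : nat) : finType :=
  ('S_n * {ffun 'I_n -> 'I_r})%type.

Section ColoredStatistics.
Variables r n : nat.
Implicit Type w : colored_perm r n.

Definition excA w : nat :=
  #|[set i : 'I_n | (w.2 i == 0%N :> nat) && (i < w.1 i)%N]|.
Definition cfix w : nat :=
  #|[set i : 'I_n | (w.1 i == i) && (w.2 i == 0%N :> nat)]|.
Definition single w : nat :=
  #|[set i : 'I_n | (w.1 i == i) && (0 < w.2 i)%N]|.
(* The three sets counted above are pairwise disjoint, so the natural number
   subtractions never truncate. *)
Definition aexcA w : nat := (n - excA w - cfix w - single w)%N.
Definition csum w : nat := (\sum_(i < n) w.2 i)%N.
Definition ccyc w : nat := pcyc w.1.

End ColoredStatistics.

(* The generating polynomials are given by their values at arbitrary elements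
   of a commutative ring; the polynomials themselves are the values at the
   indeterminates of a polynomial ring. *)

Definition bracket (R : comNzRingType) (m : nat) (p : R) : R :=
  \sum_(i < m) p ^+ i.

Definition A_poly (R : comNzRingType) (n : nat) (x p q : R) : R :=
  \sum_(pi : 'S_n) x ^+ pexc pi * p ^+ pfix pi * q ^+ pcyc pi.

Definition A_col (R : comNzRingType) (r n : nat) (x y s t p q : R) : R :=
  \sum_(w : colored_perm r n)
     x ^+ excA w * y ^+ aexcA w * s ^+ single w * t ^+ cfix w *
     p ^+ csum w * q ^+ ccyc w.

(* Main.v *)
Require Import Defs.
From mathcomp Require Import all_boot all_order all_algebra all_fingroup.
From mathcomp Require Import zify ring.

(** For a fixed [pi], both sides are products over the positions: each position
    contributes a factor depending only on its type (excedance, drop or fixed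
    point) and on its color, so summing over all colorings replaces each factor
    by the sum over the [r] colors of one position. The second form follows by
    taking [bracket r p * y] out of each of the
    [n = pexc pi + pdrop pi + pfix pi] factors. *)

Import GRing.Theory.
Local Open Scope ring_scope.

Lemma card_set_sum (T : finType) (P : pred T) :
  #|[set i | P i]| = (\sum_i P i)%N.
Proof. by rewrite -sum1dep_card big_mkcond. Qed.

Lemma exprcard_set (R : comNzRingType) (T : finType) (P : pred T) (x : R) :
  x ^+ #|[set i | P i]| = \prod_i x ^+ P i.
Proof. by rewrite card_set_sum prodrXr. Qed.

Lemma pexc_pdrop_pfix (n : nat) (pi : 'S_n) :
  (pexc pi + pdrop pi + pfix pi)%N = n.
Proof.
rewrite /pexc /pdrop /pfix !card_set_sum -!big_split /=.
rewrite -[RHS]card_ord -sum1_card; apply: eq_bigr => i _.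
by rewrite -val_eqE /=; case: ltngtP.
Qed.

(** Every position lies in exactly one of this set and those counted by [excA], [cfix] and [single],
    so the subtractions are exact. As a cardinality, [aexcA] becomes a sum of local contributions,
    like the other statistics. *)
Lemma aexcAE (r n : nat) (w : colored_perm r n) :
  aexcA w = #|[set i : 'I_n | (w.1 i < i)%N || (i < w.1 i)%N && (0 < w.2 i)%N]|.
Proof.
set A := [set _ | _].
suff : (#|A| + (excA w + cfix w + single w))%N = n.
  by rewrite /aexcA; lia.
rewrite /A /excA /cfix /single !card_set_sum -!big_split /=.
rewrite -[RHS]card_ord -sum1_card; apply: eq_bigr => i _.
by rewrite -(val_eqE (w.1 i)) /=; case: ltngtP; case: (nat_of_ord (w.2 i)).
Qed.

Section ColoringSum.
Variables (R : comNzRingType) (x y s t p : R).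

(** [k] is the image of [i]: the weight sees the permutation only through this one value. *)
Definition position_weight {n : nat} (i k : 'I_n) (c : nat) : R :=
  (if (i < k)%N then (if c == 0%N then x else y)
   else if (k < i)%N then y
   else (if c == 0%N then t else s)) * p ^+ c.

Lemma colored_weightE (r n : nat) (w : colored_perm r n) :
  x ^+ excA w * y ^+ aexcA w * s ^+ single w * t ^+ cfix w * p ^+ csum w =
  \prod_i position_weight i (w.1 i) (w.2 i).
Proof.
rewrite aexcAE /excA /single /cfix !exprcard_set /csum -prodrXr -!big_split /=.
apply: eq_bigr => i _; rewrite /position_weight -(val_eqE (w.1 i)) /=.
by case: ltngtP; case: (nat_of_ord (w.2 i)) => [|c] _ /=;
  rewrite ?expr0 ?expr1 ?mulr1 ?mul1r.
Qed.

(** Only color 0 can be treated apart: the nonzero colors together give [p * bracket m p]. At a drop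
    every color gives [y], hence the full [bracket m.+1 p]. By trichotomy exactly one of the three
    exponents is 1. *)
Lemma sum_position_weight (m n : nat) (i k : 'I_n) :
  \sum_(c < m.+1) position_weight i k c =
  (x + p * bracket m p * y) ^+ (i < k)%N * (bracket m.+1 p * y) ^+ (k < i)%N *
  (t + s * p * bracket m p) ^+ (k == i).
Proof.
have sum_color (a b : R) :
    \sum_(c < m.+1) (if c == 0%N :> nat then a else b) * p ^+ c =
    a + b * (p * bracket m p).
  rewrite big_ord_recl /= expr0 mulr1 /bracket !mulr_sumr.
  by congr (_ + _); apply: eq_bigr => c _; rewrite exprS.
rewrite /position_weight -val_eqE /=; case: ltngtP => _ /=;
  rewrite ?expr0 ?expr1 ?mulr1 ?mul1r ?sum_color.
- by rewrite mulrC.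
- by rewrite -mulr_sumr mulrC.
- by rewrite mulrA.
Qed.

Lemma A_col_sum (r n : nat) (q : R) : (0 < r)%N ->
  A_col r n x y s t p q =
  \sum_(pi : 'S_n)
     (x + p * bracket (r - 1) p * y) ^+ pexc pi *
     (bracket r p * y) ^+ pdrop pi *
     (t + s * p * bracket (r - 1) p) ^+ pfix pi *
     q ^+ pcyc pi.
Proof.
case: r => // m _; rewrite subn1 /= /A_col.
under eq_bigr => w _ do rewrite colored_weightE.
rewrite -(pair_bigA _ (fun (pi : 'S_n) (c : {ffun 'I_n -> 'I_m.+1}) =>
  (\prod_i position_weight i (pi i) (c i)) * q ^+ pcyc pi)) /=.
apply: eq_bigr => pi _; rewrite -mulr_suml; congr (_ * _).
(* Colors are chosen independently, so the sum over colorings of a product is the product over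
   positions of sums over colors. *)
rewrite -(bigA_distr_bigA (fun i (c : 'I_m.+1) => position_weight i (pi i) c)).
rewrite /pexc /pdrop /pfix !exprcard_set -!big_split /=.
by apply: eq_bigr => i _; rewrite sum_position_weight.
Qed.

End ColoringSum.

(** Trichotomy gives [b ^+ n] one factor [b] per position: those at drops stay, the others cancel
    the denominators. *)
Lemma homogenize_perm_sum (R : comUnitRingType) (n : nat) (a b f q : R) :
  b \is a GRing.unit ->
  \sum_(pi : 'S_n) a ^+ pexc pi * b ^+ pdrop pi * f ^+ pfix pi * q ^+ pcyc pi =
  b ^+ n * A_poly n (a / b) (f / b) q.
Proof.
move=> ub; rewrite /A_poly mulr_sumr; apply: eq_bigr => pi _.
have -> : b ^+ n = b ^+ pexc pi * b ^+ pdrop pi * b ^+ pfix pi.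
  by rewrite -!exprD pexc_pdrop_pfix.
have ratioX c m : c ^+ m = (c / b) ^+ m * b ^+ m by rewrite -exprMn divrK.
rewrite (ratioX a) (ratioX f).
(* With the powers made opaque, only a rearrangement of a monomial remains, without inverses. *)
by move: (_ ^+ _) (_ ^+ _) (_ ^+ _) (_ ^+ _) (_ ^+ _) (_ ^+ _) => *; ring.
Qed.

Theorem theorem51 (r n : nat) (hr : (0 < r)%N) (hn : (0 < n)%N) :
  (forall (R : comNzRingType) (x y s t p q : R),
     A_col r n x y s t p q =
     \sum_(pi : 'S_n)
        (x + p * bracket (r - 1) p * y) ^+ pexc pi *
        (bracket r p * y) ^+ pdrop pi *
        (t + s * p * bracket (r - 1) p) ^+ pfix pi *
        q ^+ pcyc pi)
  /\
  (forall (R : comUnitRingType) (x y s t p q : R),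
     bracket r p * y \is a GRing.unit ->
     A_col r n x y s t p q =
     bracket r p ^+ n * y ^+ n *
     A_poly n ((x + p * bracket (r - 1) p * y) / (bracket r p * y))
              ((t + s * p * bracket (r - 1) p) / (bracket r p * y)) q).
Proof.
split=> R x y s t p q; first exact: A_col_sum.
by move=> ub; rewrite A_col_sum // homogenize_perm_sum // exprMn.
Qed.
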